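(* Let $N\ge1$ and $a\in\{1,\dots,N\}$. For any positive integer $k$, $$ (\mathcal M^a_N)^k=\sum_{\substack{I_1,\ldots,I_k\subset\{1,\dots,N\}\\ |I_1|=\dots=|I_k|=a}}\Bigg(\prod_{\ell=1}^{k}\ \prod_{i\in I_\ell}\ \prod_{j\in\{1,\dots,N\}\setminus I_\ell}\frac{t\,q^{m_{<\ell}(i)}x_i-q^{m_{<\ell}(j)}x_j}{q^{m_{<\ell}(i)}x_i-q^{m_{<\ell}(j)}x_j}\Bigg)\,\Gamma_{I_1}\cdots\Gamma_{I_k}, $$ where, for each tuple $(I_1,\dots,I_k)$, $m_{<\ell}(j):=|\{r: 1\le r<\ell,\ j\in I_r\}|$.
   Context: Let $q,t$ be formal parameters and $x_1,\dots,x_N$ independent variables. $\Gamma_i$ denotes the $q$-shift operator on rational functions replacing $x_i$ by $q x_i$ and fixing the other variables, and $\Gamma_I=\prod_{i\in I}\Gamma_i$. Rational functions act by multiplication. The operator considered is $$ \mathcal M^a_N=\sum_{\substack{I\subset\{1,\dots,N\}\\ |I|=a}}C_I(x)\,\Gamma_I,\qquad C_I(x)=\prod_{i\in I}\ \prod_{j\in\{1,\dots,N\}\setminus I}\frac{t x_i-x_j}{x_i-x_j}, $$ that is, the level-$a$ Macdonald operator normalized without the prefactor $t^{\binom a2}$. *)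

(* Defs.v *)
From HB Require Import structures.
From mathcomp Require Import all_boot all_order all_algebra.
From mathcomp Require Import generic_quotient fraction mpoly.

Set Implicit Arguments.
Unset Strict Implicit.
Unset Printing Implicit Defensive.

Import GRing.Theory.
Local Open Scope ring_scope.

Notation tofrac := (@FracField.tofrac _).

Section FractionMap.

Variable R : idomainType.

(* phi applied to an arbitrary numerator and denominator of f; for an injective
   ring morphism the value does not depend on this choice, see fracmap_div. *)
Definition fracmap (phi : R -> R) (f : {fraction R}) : {fraction R} :=
  tofrac (phi \n_(repr f)) / tofrac (phi \d_(repr f)).

Lemma frac_numden (f : {fraction R}) :
  f = tofrac \n_(repr f) / tofrac \d_(repr f).
Proof.
apply: (canRL (mulfK _)); first by rewrite tofrac_eq0 denom_ratioP.
elim/quotW: f => f; rewrite !piE; unlock FracField.tofrac.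
apply/eqmodP.
rewrite /= FracField.equivfE /FracField.mulf /= !numden_Ratio ?oner_eq0 //.
  by rewrite !mulr1 FracField.equivf_r mulrC.
all: by rewrite ?mulr1 denom_ratioP.
Qed.

Lemma frac_ind (P : {fraction R} -> Prop) :
  (forall p r : R, r != 0 -> P (tofrac p / tofrac r)) -> forall f, P f.
Proof. by move=> Pdiv f; rewrite [f]frac_numden; apply/Pdiv/denom_ratioP. Qed.

Variable phi : {rmorphism R -> R}.
Hypothesis phi_eq0 : forall p, (phi p == 0) = (p == 0).

Lemma fracmap_div (p r : R) : r != 0 ->
  fracmap phi (tofrac p / tofrac r) = tofrac (phi p) / tofrac (phi r).
Proof.
move=> r0; set f := _ / _; rewrite /fracmap.
have d0 : \d_(repr f) != 0 by exact: denom_ratioP.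
apply/eqP; rewrite eqr_div ?tofrac_eq0 ?phi_eq0 //.
rewrite -!tofracM -!rmorphM tofrac_eq; apply/eqP; congr (phi _).
have /eqP := esym (frac_numden f).
by rewrite {3}/f eqr_div ?tofrac_eq0 // -!tofracM tofrac_eq => /eqP.
Qed.

Lemma fracmap_tofrac (p : R) : fracmap phi (tofrac p) = tofrac (phi p).
Proof. by have := fracmap_div p (oner_neq0 _); rewrite !rmorph1 !divr1. Qed.

Lemma fracmap_is_zmod_morphism : zmod_morphism (fracmap phi).
Proof.
elim/frac_ind=> p r r0; elim/frac_ind=> p' r' r'0.
rewrite -mulNr addf_div ?tofrac_eq0 // -!tofracN -!tofracM -tofracD.
rewrite !fracmap_div ?mulf_neq0 // -mulNr addf_div ?tofrac_eq0 ?phi_eq0 //.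
by rewrite -!tofracN -!tofracM -tofracD rmorphD !rmorphM rmorphN.
Qed.

Lemma fracmap_is_monoid_morphism : monoid_morphism (fracmap phi).
Proof.
split=> [|]; first by rewrite -tofrac1 fracmap_tofrac rmorph1.
elim/frac_ind=> p r r0; elim/frac_ind=> p' r' r'0.
rewrite mulf_div -!tofracM !fracmap_div ?mulf_neq0 //.
by rewrite mulf_div -!tofracM !rmorphM.
Qed.

End FractionMap.

Notation ratfun F N := {fraction {mpoly F[N]}}.

Section MacdonaldOperators.

Variables (F : fieldType) (N : nat).

Definition cst (c : F) : ratfun F N := tofrac c%:MP.
Definition xvar (i : 'I_N) : ratfun F N := tofrac 'X_i.

Definition opcomp (A B : ratfun F N -> ratfun F N) : ratfun F N -> ratfun F N :=
  A \o B.

Definition mult_before (k : nat) (I : {ffun 'I_k -> {set 'I_N}}) (l : 'I_k)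
    (j : 'I_N) : nat :=
  #|[set r : 'I_k | (r < l)%N && (j \in I r)]|.

Variables q t : F.

Definition qshift_poly (i : 'I_N) (p : {mpoly F[N]}) : {mpoly F[N]} :=
  p \mPo [tuple (if j == i then q *: 'X_j else 'X_j) | j < N].

Definition qshift (i : 'I_N) : ratfun F N -> ratfun F N :=
  fracmap (qshift_poly i).

(* The order of the factors is irrelevant, see qshiftC. *)
Definition qshift_set (I : {set 'I_N}) : ratfun F N -> ratfun F N :=
  \big[opcomp/id]_(i in I) qshift i.

Definition macdonald (a : nat) (f : ratfun F N) : ratfun F N :=
  \sum_(I : {set 'I_N} | #|I| == a)
    (\prod_(i in I) \prod_(j in ~: I)
       ((cst t * xvar i - xvar j) / (xvar i - xvar j)))
    * qshift_set I f.

HB.instance Definition _ (i : 'I_N) :=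
  GRing.RMorphism.copy (qshift_poly i)
    (comp_mpoly [tuple (if j == i then q *: 'X_j else 'X_j) | j < N]).

HB.instance Definition _ (i : 'I_N) :=
  GRing.Linear.copy (qshift_poly i)
    (comp_mpoly [tuple (if j == i then q *: 'X_j else 'X_j) | j < N]).

Lemma qshift_polyXU (i j : 'I_N) :
  qshift_poly i 'X_j = if j == i then q *: 'X_j else 'X_j.
Proof. by rewrite /qshift_poly comp_mpolyXU -tnth_nth tnth_mktuple. Qed.

Lemma qshift_polyX (i : 'I_N) (m : 'X_{1..N}) :
  qshift_poly i 'X_[m] = q ^+ m i *: 'X_[m].
Proof.
rewrite /qshift_poly comp_mpolyX (bigD1 i) //= tnth_mktuple eqxx exprZn.
rewrite -scalerAl; congr (_ *: _); rewrite [RHS]mpolyXE_id [RHS](bigD1 i) //=.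
by congr (_ * _); apply: eq_bigr => j /negbTE ji; rewrite tnth_mktuple ji.
Qed.

Lemma mcoeff_qshift_poly (i : 'I_N) p (m : 'X_{1..N}) :
  (qshift_poly i p)@_m = q ^+ m i * p@_m.
Proof.
have -> : qshift_poly i p
    = \sum_(m' <- msupp p) p@_m' *: qshift_poly i 'X_[m'].
  rewrite [in LHS](mpolyE p) (raddf_sum (qshift_poly i)) /=.
  by apply: eq_bigr => m' _; rewrite (linearZ_LR (qshift_poly i)).
rewrite (raddf_sum (mcoeff m)) /= [in RHS](mpolyE p) (raddf_sum (mcoeff m)) /=.
rewrite mulr_sumr; apply: eq_bigr => m' _.
rewrite qshift_polyX !mcoeffZ mcoeffX.
by case: eqVneq => [->|_]; rewrite ?mulr0 // !mulr1 mulrC.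
Qed.

Hypothesis q_neq0 : q != 0.

Lemma qshift_poly_eq0 (i : 'I_N) p : (qshift_poly i p == 0) = (p == 0).
Proof.
apply/eqP/eqP => [/mpolyP h|->]; last exact: raddf0.
apply/mpolyP => m; move: (h m); rewrite mcoeff_qshift_poly mcoeff0.
by move/eqP; rewrite mulf_eq0 expf_eq0 (negbTE q_neq0) andbF /= => /eqP.
Qed.

Lemma qshift_div (i : 'I_N) (p r : {mpoly F[N]}) : r != 0 ->
  qshift i (tofrac p / tofrac r)
  = tofrac (qshift_poly i p) / tofrac (qshift_poly i r).
Proof. exact: (fracmap_div (qshift_poly_eq0 i)). Qed.

Lemma qshift_tofrac (i : 'I_N) (p : {mpoly F[N]}) :
  qshift i (tofrac p) = tofrac (qshift_poly i p).
Proof. exact: (fracmap_tofrac (qshift_poly_eq0 i)). Qed.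

Lemma qshift_cst (i : 'I_N) (c : F) : qshift i (cst c) = cst c.
Proof. by rewrite qshift_tofrac /qshift_poly comp_mpolyC. Qed.

Lemma qshift_xvar (i j : 'I_N) :
  qshift i (xvar j) = if j == i then cst q * xvar j else xvar j.
Proof.
rewrite qshift_tofrac qshift_polyXU; case: ifP => // _.
by rewrite -mul_mpolyC rmorphM.
Qed.

Lemma qshift_is_zmod_morphism (i : 'I_N) : zmod_morphism (qshift i).
Proof. exact: (fracmap_is_zmod_morphism (qshift_poly_eq0 i)). Qed.

Lemma qshift_is_monoid_morphism (i : 'I_N) : monoid_morphism (qshift i).
Proof. exact: (fracmap_is_monoid_morphism (qshift_poly_eq0 i)). Qed.

Lemma qshiftC (i j : 'I_N) : qshift i \o qshift j =1 qshift j \o qshift i.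
Proof.
have comm (p : {mpoly F[N]}) :
    qshift_poly i (qshift_poly j p) = qshift_poly j (qshift_poly i p).
  by apply/mpolyP => m; rewrite !mcoeff_qshift_poly mulrCA.
elim/frac_ind=> p r r0; rewrite /comp.
have nz l : qshift_poly l r != 0 by rewrite qshift_poly_eq0.
rewrite (qshift_div j p r0) (qshift_div i p r0).
by rewrite (qshift_div i _ (nz j)) (qshift_div j _ (nz i)) !comm.
Qed.

End MacdonaldOperators.

Arguments cst {F N} c.
Arguments xvar {F N} i.
Arguments opcomp {F N} A B.

(* The field K(q,t) over a field of constants K, and its two generators. *)
Notation qtfield K := {fraction {mpoly K[2]}}.

Definition qpar (K : fieldType) : qtfield K := tofrac 'X_ord0.
Definition tpar (K : fieldType) : qtfield K := tofrac 'X_ord_max.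

Lemma qpar_neq0 (K : fieldType) : qpar K != 0.
Proof. by rewrite tofrac_eq0 -msupp_eq0 msuppX. Qed.

(* Main.v *)
Require Import Defs.
From HB Require Import structures.
From mathcomp Require Import all_boot all_order all_algebra.
From mathcomp Require Import generic_quotient fraction mpoly.

Set Implicit Arguments.
Unset Strict Implicit.
Unset Printing Implicit Defensive.

Import GRing.Theory.
Local Open Scope ring_scope.

(** Each q-shift is a ring endomorphism of the field of rational functions that
    fixes constants and scales the variables, so moving [qshift_set J] past a
    coefficient adds one power of [q] to every [x_i] with [i \in J].  Expanding
    the [k]-fold composition of the Macdonald operator and moving all shifts to
    the right therefore leaves, in front of the shifts attached to
    [I_1, ..., I_k], the product of the coefficients of the [I_l] with [x_i]
    scaled by [q] once for every [r < l] such that [i \in I_r], which is the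
    multiplicity [mult_before I l i].

    The induction on [k] splits off the outermost operator, that is the first
    set [J] of the tuple ([big_ffun_cons]).  Its coefficient is unshifted; its
    shift acts on every later coefficient ([qshift_set_scaled_coef]), which
    matches the recursion of the multiplicities under prepending [J]
    ([mult_before_lift]).  The argument works for every nonzero [q] in every
    field ([iter_macdonald]). *)

Section FfunCons.

Variables (T : finType) (k : nat).

Definition ffun_cons (x : T) (g : {ffun 'I_k -> T}) : {ffun 'I_k.+1 -> T} :=
  [ffun l => oapp g x (unlift ord0 l)].

Lemma ffun_cons0 x g : ffun_cons x g ord0 = x.
Proof. by rewrite ffunE unlift_none. Qed.

Lemma ffun_consS x g l : ffun_cons x g (lift ord0 l) = g l.
Proof. by rewrite ffunE liftK. Qed.

Lemma forall_ffun_cons (P : pred T) x g :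
  [forall l, P (ffun_cons x g l)] = P x && [forall l, P (g l)].
Proof.
apply/forallP/andP => [Pxg|[Px /forallP Pg] l].
  split; first by have := Pxg ord0; rewrite ffun_cons0.
  by apply/forallP => l; have := Pxg (lift ord0 l); rewrite ffun_consS.
by case: (unliftP ord0 l) => [l' ->|->]; rewrite ?ffun_consS ?ffun_cons0.
Qed.

Lemma big_ffun_cons (V : nmodType) (P : pred T) (G : {ffun 'I_k.+1 -> T} -> V) :
  \sum_(h : {ffun 'I_k.+1 -> T} | [forall l, P (h l)]) G h =
  \sum_(x | P x) \sum_(g : {ffun 'I_k -> T} | [forall l, P (g l)])
    G (ffun_cons x g).
Proof.
pose tail (h : {ffun 'I_k.+1 -> T}) : {ffun 'I_k -> T} :=
  [ffun l => h (lift ord0 l)].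
rewrite pair_big /= (reindex (fun p => ffun_cons p.1 p.2)) /=.
  by apply: eq_bigl => -[x g]; rewrite forall_ffun_cons.
apply: onW_bij.
exists (fun h : {ffun 'I_k.+1 -> T} => (h ord0, tail h)) => [[x g]|h] /=.
  by rewrite ffun_cons0; congr (_, _); apply/ffunP => l;
    rewrite ffunE ffun_consS.
apply/ffunP => l.
by case: (unliftP ord0 l) => [l' ->|->]; rewrite ?ffun_consS ?ffun_cons0 ?ffunE.
Qed.

End FfunCons.

Section MultBefore.

Variables (N k : nat) (J : {set 'I_N}) (I : {ffun 'I_k -> {set 'I_N}}).

Lemma mult_before0 j : mult_before (ffun_cons J I) ord0 j = 0%N.
Proof. by apply: eq_card0 => r; rewrite inE ltn0. Qed.

(** [J] comes before every entry of [I], so it contributes to all their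
    multiplicities alike. *)
Lemma mult_before_lift l j :
  mult_before (ffun_cons J I) (lift ord0 l) j
  = ((j \in J) + mult_before I l j)%N.
Proof.
rewrite /mult_before -!sum1_card [LHS]big_mkcond big_ord_recl /=.
rewrite inE ffun_cons0 ltn0Sn /=; congr (_ + _)%N.
rewrite [RHS]big_mkcond; apply: eq_bigr => r _.
by rewrite !inE ffun_consS !lift0 ltnS.
Qed.

End MultBefore.

Section MacdonaldPowers.

Variables (F : fieldType) (N : nat) (q t : F).
Hypothesis q_neq0 : q != 0.

HB.instance Definition _ (i : 'I_N) :=
  GRing.isZmodMorphism.Build _ _ (qshift q i)
    (qshift_is_zmod_morphism q_neq0 i).

HB.instance Definition _ (i : 'I_N) :=
  GRing.isMonoidMorphism.Build _ _ (qshift q i)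
    (qshift_is_monoid_morphism q_neq0 i).

Lemma qshift_set_is_zmod_morphism (I : {set 'I_N}) :
  zmod_morphism (qshift_set q I : ratfun F N -> ratfun F N).
Proof.
rewrite /qshift_set; elim/big_ind: _ => // [g h gB hB | i _] x y.
  by rewrite /opcomp /= hB gB.
exact: rmorphB.
Qed.

Lemma qshift_set_is_monoid_morphism (I : {set 'I_N}) :
  monoid_morphism (qshift_set q I : ratfun F N -> ratfun F N).
Proof.
rewrite /qshift_set; elim/big_ind: _ => // [g h [g1 gM] [h1 hM] | i _].
  by split=> [|x y]; rewrite /opcomp /= ?h1 ?g1 // hM gM.
by split; [exact: rmorph1 | exact: rmorphM].
Qed.

HB.instance Definition _ (I : {set 'I_N}) :=
  GRing.isZmodMorphism.Build _ _ (qshift_set q I)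
    (qshift_set_is_zmod_morphism I).

HB.instance Definition _ (I : {set 'I_N}) :=
  GRing.isMonoidMorphism.Build _ _ (qshift_set q I)
    (qshift_set_is_monoid_morphism I).

Lemma qshift_set_cst (I : {set 'I_N}) (c : F) :
  qshift_set q I (cst c) = cst c :> ratfun F N.
Proof.
rewrite /qshift_set; elim/big_ind: _ => // [g h gc hc | i _].
  by rewrite /opcomp /= hc gc.
exact: qshift_cst.
Qed.

Lemma qshift_set_xvar (I : {set 'I_N}) (j : 'I_N) :
  qshift_set q I (xvar j) = cst q ^+ (j \in I) * xvar j.
Proof.
(* Only the shift at j moves x_j, and it occurs once because the enumeration of
   the indices has no repetition; the induction is over duplicate-free lists. *)
suff shift_seq r : uniq r ->
    (\big[opcomp/id]_(i <- r | i \in I) qshift q i) (xvar j)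
    = cst q ^+ ((j \in I) && (j \in r)) * xvar j.
  by rewrite /qshift_set shift_seq ?index_enum_uniq // mem_index_enum andbT.
elim: r => [_|i r IHr /= /andP[ir /IHr{}IHr]].
  by rewrite big_nil andbF mul1r.
rewrite big_cons inE; case: ifP => iI; last first.
  by rewrite IHr; case: (eqVneq j i) => // ->; rewrite iI.
rewrite /opcomp /= IHr rmorphM rmorphXn /= qshift_cst // qshift_xvar //.
by case: (eqVneq j i) => // ->; rewrite iI (negbTE ir) expr0 mul1r expr1.
Qed.

(** The coefficient of [qshift_set q I] in the Macdonald operator, evaluated at
    the point with coordinates [q ^+ m i * x_i]. *)
Definition scaled_coef (m : 'I_N -> nat) (I : {set 'I_N}) : ratfun F N :=
  \prod_(i in I) \prod_(j in ~: I)
    ((cst t * cst q ^+ m i * xvar i - cst q ^+ m j * xvar j)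
     / (cst q ^+ m i * xvar i - cst q ^+ m j * xvar j)).

Lemma eq_scaled_coef m m' I : m =1 m' -> scaled_coef m I = scaled_coef m' I.
Proof.
by move=> mm'; apply: eq_bigr => i _; apply: eq_bigr => j _; rewrite !mm'.
Qed.

Lemma macdonaldE a f :
  macdonald q t a f =
  \sum_(I : {set 'I_N} | #|I| == a)
    scaled_coef (fun=> 0%N) I * qshift_set q I f.
Proof.
apply: eq_bigr => I _; congr (_ * _).
by apply: eq_bigr => i _; apply: eq_bigr => j _; rewrite expr0 mulr1 !mul1r.
Qed.

(** The family [scaled_coef] is stable under shifts because a shift only changes
    the powers of [q] in front of the variables; this is what keeps the
    coefficients of the expansion in product form. *)
Lemma qshift_set_scaled_coef (J I : {set 'I_N}) m :
  qshift_set q J (scaled_coef m I)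
  = scaled_coef (fun i => (i \in J) + m i)%N I.
Proof.
have shift_pow i : qshift_set q J (cst q ^+ m i * xvar i)
    = cst q ^+ ((i \in J) + m i) * xvar i.
  by rewrite rmorphM rmorphXn /= qshift_set_cst qshift_set_xvar mulrA -exprD
    addnC.
rewrite rmorph_prod; apply: eq_bigr => i _.
rewrite rmorph_prod; apply: eq_bigr => j _.
by rewrite -!mulrA fmorph_div !rmorphB /= rmorphM /= qshift_set_cst !shift_pow.
Qed.

(** The empty power [k = 0] starts the induction: the only tuple is the empty
    one, with coefficient 1 and the identity as its shift. *)
Lemma iter_macdonald a k f :
  iter k (macdonald q t a) f =
  \sum_(I : {ffun 'I_k -> {set 'I_N}} | [forall l, #|I l| == a])
    (\prod_(l < k) scaled_coef (mult_before I l) (I l))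
    * (\big[opcomp/id]_(l < k) qshift_set q (I l)) f.
Proof.
elim: k => [|k IHk] /=.
  pose I0 : {ffun 'I_0 -> {set 'I_N}} := [ffun=> set0].
  rewrite (big_pred1 I0) => [|I]; first by rewrite !big_ord0 mul1r.
  have -> : I = I0 by apply/ffunP; case.
  by rewrite /= eqxx; apply/forallP; case.
rewrite IHk macdonaldE (big_ffun_cons (fun X : {set 'I_N} => #|X| == a)) /=.
apply: eq_bigr => J _; rewrite rmorph_sum mulr_sumr; apply: eq_bigr => I _.
rewrite rmorphM rmorph_prod mulrA !big_ord_recl /opcomp /= ffun_cons0.
congr (_ * _ * qshift_set q J _).
- by apply: eq_scaled_coef => j; rewrite mult_before0.
- apply: eq_bigr => l _; rewrite ffun_consS qshift_set_scaled_coef.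
  by apply: eq_scaled_coef => j; rewrite mult_before_lift.
- by congr (_ f); apply: eq_bigr => l _; rewrite ffun_consS.
Qed.

End MacdonaldPowers.

Theorem theorem3p11 (K : fieldType) (N a k : nat)
    (hN : (1 <= N)%N) (ha : (1 <= a <= N)%N) (hk : (0 < k)%N)
    (f : ratfun (qtfield K) N) :
  let q := qpar K in
  let t := tpar K in
  iter k (macdonald q t a) f =
  \sum_(I : {ffun 'I_k -> {set 'I_N}} | [forall l, #|I l| == a])
    (\prod_(l < k) \prod_(i in I l) \prod_(j in ~: I l)
       ((cst t * cst q ^+ mult_before I l i * xvar i
           - cst q ^+ mult_before I l j * xvar j)
        / (cst q ^+ mult_before I l i * xvar i
           - cst q ^+ mult_before I l j * xvar j)))
    * (\big[opcomp/id]_(l < k) qshift_set q (I l)) f.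
Proof. exact: iter_macdonald (qpar_neq0 K) a k f. Qed.
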